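(* Let $t\ge 0$ be an integer and let $I\subset K[x_1,\dots,x_n]$ be a $t$-spread strongly stable ideal. Then $\beta_{i,i+j}(I)=\beta_{i,i+j}(I^{\sigma})$ for all $i$ and $j$.
   Context: $K$ is a field. A monomial $x_{i_1}x_{i_2}\cdots x_{i_d}$ with $i_1\le i_2\le\cdots\le i_d$ is called $t$-spread if $i_j-i_{j-1}\ge t$ for $2\le j\le d$. A $t$-spread monomial ideal is an ideal generated by $t$-spread monomials. For a monomial $u$, $\operatorname{supp}(u)=\{j : x_j \text{ divides } u\}$. A $t$-spread monomial ideal $I$ is called $t$-spread strongly stable if for all $t$-spread monomials $u\in I$, all $j\in\operatorname{supp}(u)$ and all $i<j$ such that $x_i(u/x_j)$ is $t$-spread, one has $x_i(u/x_j)\in I$. $G(I)$ denotes the unique minimal set of monomial generators of a monomial ideal $I$. For $u=x_{i_1}\cdots x_{i_d}$ with $i_1\le\cdots\le i_d$ put $\sigma(u)=\prod_{j=1}^d x_{i_j+(j-1)}$; $I^{\sigma}$ is the ideal generated by the monomials $\sigma(u)$ with $u\in G(I)$, in a polynomial ring $K[x_1,\dots,x_N]$ with $N$ large enough to contain these monomials (the graded Betti numbers do not depend on $N$). $\beta_{i,k}(I)=\dim_K \operatorname{Tor}_i(K,I)_k$ are the graded Betti numbers over the polynomial ring. *)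

(* Defs.v *)
From HB Require Import structures.
From mathcomp Require Import all_boot all_order all_algebra.
From mathcomp Require Export mpoly.

Set Implicit Arguments.
Unset Strict Implicit.
Unset Printing Implicit Defensive.

Import GRing.Theory.
Local Open Scope ring_scope.

(* The variables x_1, ..., x_n are indexed by 'I_n, so all indices are shifted
   down by 1; [tspread], [sigma] and the stability condition are invariant
   under this shift. *)

(* The sequence i_1 <= ... <= i_d with m = x_{i_1} ... x_{i_d}. *)
Definition mon_indices n (m : 'X_{1..n}) : seq nat :=
  flatten [seq nseq (m i) (i : nat) | i <- enum 'I_n].

Definition tspread t n (m : 'X_{1..n}) : bool :=
  sorted (fun a b : nat => (a + t <= b)%N) (mon_indices m).

Definition sigma_indices n (m : 'X_{1..n}) : seq nat :=
  let s := mon_indices m in mkseq (fun j => (nth 0 s j + j)%N) (size s).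

(* sigma(m) as a monomial in N variables; indices >= N would be dropped, so this
   is only meaningful when every element of [sigma_indices m] is < N. *)
Definition sigma N n (m : 'X_{1..n}) : 'X_{1..N} :=
  [multinom count_mem (i : nat) (sigma_indices m) | i < N].

Section Ideals.
Variables (K : fieldType) (n : nat).
Implicit Types (I : {mpoly K[n]} -> Prop) (A B G : 'X_{1..n} -> Prop).

Definition monomial_ideal A : {mpoly K[n]} -> Prop := fun p =>
  exists s : seq ({mpoly K[n]} * 'X_{1..n}),
    (forall q, q \in s -> A q.2) /\ p = \sum_(q <- s) q.1 * 'X_[q.2].

Definition generates A I : Prop := forall p, I p <-> monomial_ideal A p.

Definition tspread_monomial_ideal t I : Prop :=
  exists A, (forall m, A m -> tspread t m) /\ generates A I.

Definition tspread_strongly_stable t I : Prop :=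
  tspread_monomial_ideal t I /\
  forall (u : 'X_{1..n}) (i j : 'I_n),
    tspread t u -> I 'X_[u] -> (0 < u j)%N -> (i < j)%N ->
    tspread t (u - U_(j) + U_(i))%MM -> I 'X_[(u - U_(j) + U_(i))%MM].

Definition minimal_generating_set I G : Prop :=
  generates G I /\
  forall B, (forall m, B m -> G m) -> generates B I -> forall m, G m -> B m.

(* G(I), for a monomial ideal I: its minimal generating set is unique. *)
Definition mingens I : 'X_{1..n} -> Prop := fun u =>
  exists G, minimal_generating_set I G /\ G u.

End Ideals.

Definition sigma_ideal (K : fieldType) n N (I : {mpoly K[n]} -> Prop) :
    {mpoly K[N]} -> Prop :=
  monomial_ideal (fun w => exists2 u, mingens I u & w = sigma N u).

(* A sequence ... -> F_1 -> F_0 -> S over S = K[x_1, ..., x_n], where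
   F_i = \bigoplus_a S(- gdeg i a) has finite rank [rk i]. Elements of F_i are row
   vectors, and maps act by multiplication on the right. *)
Record free_seq (K : fieldType) n := FreeSeq {
  rk : nat -> nat;
  gdeg : forall i, 'I_(rk i) -> int;
  diff : forall i, 'M[{mpoly K[n]}]_(rk i.+1, rk i);
  aug : 'cV[{mpoly K[n]}]_(rk 0)
}.

Section Resolutions.
Variables (K : fieldType) (n : nat).
Implicit Types (F : free_seq K n) (I : {mpoly K[n]} -> Prop).

(* p is homogeneous of degree d; p = 0 is allowed, and is forced when d < 0. *)
Definition homog_of_degree (d : int) (p : {mpoly K[n]}) : Prop :=
  forall m, m \in msupp p -> (mdeg m)%:Z = d.

Definition is_graded F : Prop :=
  (forall a, homog_of_degree (gdeg a) (aug F a 0)) /\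
  (forall i a b, homog_of_degree (gdeg a - gdeg b) (diff F i a b)).

(* Exactness of ... -> F_1 -> F_0 -> I -> 0. *)
Definition is_exact F I : Prop :=
  [/\ forall p, I p <-> exists v : 'rV_(rk F 0), p = (v *m aug F) 0 0,
      forall v : 'rV_(rk F 0),
        v *m aug F = 0 <-> exists w : 'rV_(rk F 1), v = w *m diff F 0
    & forall i (v : 'rV_(rk F i.+1)),
        v *m diff F i = 0 <-> exists w : 'rV_(rk F i.+2), v = w *m diff F i.+1].

Definition graded_free_resolution F I : Prop := is_graded F /\ is_exact F I.

(* The differential of K (x)_S F, with K = S / (x_1, ..., x_n): every polynomial
   entry is reduced to its constant term. *)
Definition tor_diff F i : 'M[K]_(rk F i.+1, rk F i) :=
  map_mx (fun p : {mpoly K[n]} => p@_0%MM) (diff F i).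

(* Projection onto (K (x) F_i)_k, which is spanned by the basis elements of
   degree k. *)
Definition tor_proj F i (k : int) : 'M[K]_(rk F i) :=
  diag_mx (\row_a (gdeg a == k)%:R).

Definition tor_cycles F i : 'M[K]_(rk F i) :=
  match i return 'M[K]_(rk F i) with
  | 0 => 1%:M
  | i'.+1 => kermx (tor_diff F i')
  end.

(* beta_{i,k}(I) = dim_K Tor_i(K, I)_k = dim_K H_i(K (x) F)_k, for F a graded
   free resolution of I: cycles of degree k modulo boundaries of degree k. *)
Definition graded_betti F i (k : int) : nat :=
  (\rank (tor_proj F i k :&: tor_cycles F i)%MS
   - \rank (tor_proj F i.+1 k *m tor_diff F i))%N.

End Resolutions.

(* Main.v *)
Require Import Defs.
From Stdlib Require Import Classical_Prop IndefiniteDescription.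
From HB Require Import structures.
From mathcomp Require Import all_boot all_order all_algebra.
From mathcomp Require Import mpoly zify.

Set Implicit Arguments.
Unset Strict Implicit.
Unset Printing Implicit Defensive.

Import GRing.Theory.
Local Open Scope ring_scope.

(* Sort the minimal generators of a t-spread strongly stable ideal by degree and then by
   the sum of the indices. The ideal of the generators preceding u, divided by u, is then
   generated by those variables x_i that can replace some x_j with j > i in u without
   destroying t-spreadness. Iterated mapping cones of Koszul complexes yield a graded
   resolution, which is minimal because the degrees increase. Any two resolutions are
   homotopy equivalent, hence beta_{i,i+j} = \sum_{deg u = j} C(q(u), i), where q(u) is
   the number of such variables.
   The ideal I^sigma is (t+1)-spread strongly stable with minimal generators sigma(u), and
   the gaps between the successive (t+1)-spread indices of sigma(u) are as long as those
   between the t-spread indices of u, so q(sigma(u)) = q(u). *)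

(** Chain maps and homotopies are built with this one place at a time, the type of the matrix
    depending on the place. The invariant [P] records what makes the next choice possible. *)
Lemma dependent_choice_from (T : nat -> Type) (P : forall i, T i -> Prop)
    (R : forall i, T i -> T i.+1 -> Prop) (x0 : T 0) :
  P 0 x0 -> (forall i x, P i x -> exists y, P i.+1 y /\ R i x y) ->
  exists f : forall i, T i,
    [/\ f 0 = x0, forall i, P i (f i) & forall i, R i (f i) (f i.+1)].
Proof.
move=> P0 PS.
have next i (x : {x : T i | P i x}) :
    {y : {y : T i.+1 | P i.+1 y} | R i (sval x) (sval y)}.
  have [y [Py Rxy]] := constructive_indefinite_description _ (PS i _ (svalP x)).
  by exists (exist _ y Py).
pose f := fix f i : {x : T i | P i x} :=
  match i with 0 => exist _ x0 P0 | i'.+1 => sval (next i' (f i')) end.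
exists (fun i => sval (f i)); split=> // i; first exact: svalP.
exact: (svalP (next i (f i))).
Qed.

(** * Homogeneous components of polynomials *)

Section HomogeneousPart.
Variables (K : fieldType) (n : nat).
Implicit Types (p q : {mpoly K[n]}) (d e : int).

Definition hpart d p : {mpoly K[n]} :=
  \sum_(m <- msupp p | (mdeg m)%:Z == d) p@_m *: 'X_[m].

Lemma mcoeff_hpart d p m : (hpart d p)@_m = if (mdeg m)%:Z == d then p@_m else 0.
Proof.
rewrite /hpart raddf_sum /=.
under eq_bigr do rewrite mcoeffZ mcoeffX.
have [m_p|m_p] := boolP (m \in msupp p).
  rewrite big_mkcond (bigD1_seq m) ?msupp_uniq //= eqxx mulr1 big1 ?addr0 //.
  by move=> k /negPf ->; rewrite mulr0; case: ifP.
rewrite big_seq_cond big1 => [|k /andP[k_p _]].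
  by rewrite memN_msupp_eq0 //; case: ifP.
case: eqP => [k_m|_]; last by rewrite mulr0.
by rewrite -k_m k_p in m_p.
Qed.

Lemma hpart_homog d p : homog_of_degree d (hpart d p).
Proof.
move=> m; rewrite mcoeff_msupp mcoeff_hpart.
by have [//|_] := (mdeg m)%:Z =P d; rewrite eqxx.
Qed.

Lemma hpart_id d p : homog_of_degree d p -> hpart d p = p.
Proof.
move=> hp; apply/mpolyP=> m; rewrite mcoeff_hpart; case: eqP => // md.
by rewrite memN_msupp_eq0 //; apply/negP => /hp.
Qed.

Lemma hpart_sum d (J : finType) (f : J -> {mpoly K[n]}) :
  hpart d (\sum_j f j) = \sum_j hpart d (f j).
Proof.
apply/mpolyP=> m; rewrite mcoeff_hpart; case E: ((mdeg m)%:Z == d).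
  by rewrite !raddf_sum; apply: eq_bigr => j _; rewrite /= mcoeff_hpart E.
by rewrite raddf_sum big1 // => j _; rewrite /= mcoeff_hpart E.
Qed.

Lemma hpartM d e p q :
  homog_of_degree e q -> hpart d (p * q) = hpart (d - e) p * q.
Proof.
move=> hq; apply/mpolyP=> m; rewrite mcoeff_hpart !mcoeffM.
symmetry.
transitivity (\sum_(k : 'X_{1..n < (mdeg m).+1, (mdeg m).+1} |
    m == (k.1 + k.2)%MM)
    if (mdeg m)%:Z == d then p@_k.1 * q@_k.2 else 0); last first.
  by case: ((mdeg m)%:Z == d) => //; rewrite big1.
apply: eq_bigr => -[[k1 ?] [k2 ?]] /= /eqP mk; rewrite mcoeff_hpart.
have [k2q|k2q] := boolP (k2 \in msupp q); last first.
  by rewrite (memN_msupp_eq0 k2q) !mulr0; case: ifP.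
have -> : ((mdeg m)%:Z == d) = ((mdeg k1)%:Z == d - e).
  move/(congr1 mdeg): mk; rewrite mdegD => ->.
  by rewrite PoszD (hq _ k2q) eq_sym -subr_eq eq_sym.
by case: ifP; rewrite ?mul0r.
Qed.

Lemma homog_of_degreeM d e p q :
  homog_of_degree d p -> homog_of_degree e q -> homog_of_degree (d + e) (p * q).
Proof.
move=> hp hq m /msuppM_le /allpairsP[[m1 m2] /= [/hp <- /hq <- ->]].
by rewrite mdegD PoszD.
Qed.

Lemma homog_of_degreeX m : homog_of_degree (mdeg m)%:Z ('X_[m] : {mpoly K[n]}).
Proof. by move=> m'; rewrite msuppX inE => /eqP ->. Qed.

Lemma homog_of_degree0 d : homog_of_degree d (0 : {mpoly K[n]}).
Proof. by move=> m; rewrite mcoeff_msupp mcoeff0 eqxx. Qed.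

Lemma homog_of_degreeN d p : homog_of_degree d p -> homog_of_degree d (- p).
Proof. by move=> hp m; rewrite (perm_mem (msuppN p)); apply: hp. Qed.

Lemma homog_mcoeff0 d p : homog_of_degree d p -> d != 0 -> p@_0%MM = 0.
Proof.
move=> hp d0; rewrite memN_msupp_eq0 //; apply/negP=> /hp; rewrite mdeg0 => d0'.
by rewrite -d0' eqxx in d0.
Qed.

End HomogeneousPart.

(** * Graded matrices and graded solutions of linear equations *)

Section GradedMatrices.
Variables (K : fieldType) (n : nat).
Notation S := {mpoly K[n]}.

(** Matrices of maps of degree [d] between graded free modules whose basis elements have degrees [f]
    and [g]. *)
Definition graded_mx r s (f : 'I_r -> int) (g : 'I_s -> int) d (A : 'M[S]_(r, s)) :=
  forall a b, homog_of_degree (f a + d - g b) (A a b).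

Definition hpart_mx r s (f : 'I_r -> int) (g : 'I_s -> int) d (A : 'M[S]_(r, s)) :=
  \matrix_(a, b) hpart (f a + d - g b) (A a b).

Lemma hpart_mxM r s t (f : 'I_r -> int) (g : 'I_s -> int) (h : 'I_t -> int) d
    (A : 'M[S]_(r, s)) (B : 'M[S]_(s, t)) :
  graded_mx g h 0 B -> hpart_mx f h d (A *m B) = hpart_mx f g d A *m B.
Proof.
move=> hB; apply/matrixP=> a c; rewrite !mxE hpart_sum; apply: eq_bigr => b _.
rewrite (hpartM _ _ (hB b c)) mxE; congr (hpart _ _ * _).
by rewrite addr0 opprB addrA subrK.
Qed.

Lemma solve_rows r s t (A : 'M[S]_(r, t)) (B : 'M[S]_(s, t)) :
  (forall v : 'rV_r, exists w, v *m A = w *m B) -> exists X : 'M[S]_(r, s), X *m B = A.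
Proof.
move=> AB; have /fin_all_exists[X hX] : forall a, exists w, row a A = w *m B.
  by move=> a; rewrite rowE; apply: AB.
by exists (\matrix_a X a); apply/row_matrixP=> a; rewrite row_mul rowK hX.
Qed.

(** Any solution, cut down entrywise to the right degrees, is still a solution, because
    multiplication by the graded matrix [B] commutes with taking components. *)
Lemma solve_rows_graded r s t (f : 'I_r -> int) (g : 'I_s -> int) (h : 'I_t -> int) d
    (A : 'M[S]_(r, t)) (B : 'M[S]_(s, t)) :
  graded_mx f h d A -> graded_mx g h 0 B ->
  (forall v : 'rV_r, exists w, v *m A = w *m B) ->
  exists X : 'M[S]_(r, s), graded_mx f g d X /\ X *m B = A.
Proof.
move=> hA hB /solve_rows[X XB]; exists (hpart_mx f g d X); split.
  by move=> a b; rewrite mxE; apply: hpart_homog.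
rewrite -(hpart_mxM _ _ _ hB) XB; apply/matrixP=> a b.
by rewrite mxE; apply: hpart_id; apply: hA.
Qed.

Lemma graded_mxM r s t (f : 'I_r -> int) (g : 'I_s -> int) (h : 'I_t -> int) d e
    (A : 'M[S]_(r, s)) (B : 'M[S]_(s, t)) :
  graded_mx f g d A -> graded_mx g h e B -> graded_mx f h (d + e) (A *m B).
Proof.
move=> hA hB a c m; rewrite mxE => /msupp_sum_le /flatten_mapP[b _].
move/(homog_of_degreeM (hA a b) (hB b c)) ->.
by lia.
Qed.

End GradedMatrices.

(** * Comparison of resolutions: chain maps and homotopies *)

Section ChainMaps.
Variables (K : fieldType) (n : nat).
Notation S := {mpoly K[n]}.
Implicit Types (F G : free_seq K n) (I J : S -> Prop) (u : S).

Lemma graded_aug F : is_graded F -> graded_mx (@gdeg _ _ F 0) (fun=> 0) 0 (aug F).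
Proof. by case=> h _ a b; rewrite ord1 addr0 subr0; apply: h. Qed.

Lemma graded_diff F i :
  is_graded F -> graded_mx (@gdeg _ _ F i.+1) (@gdeg _ _ F i) 0 (diff F i).
Proof. by case=> _ h a b; rewrite addr0; apply: h. Qed.

Lemma exact_diff_aug F I : is_exact F I -> diff F 0 *m aug F = 0.
Proof.
case=> _ h _; apply/row_matrixP=> a; rewrite row0 rowE mulmxA.
by apply/h; exists (delta_mx 0 a).
Qed.

Lemma exact_diff_diff F I i : is_exact F I -> diff F i.+1 *m diff F i = 0.
Proof.
case=> _ _ h; apply/row_matrixP=> a; rewrite row0 rowE mulmxA.
by apply/h; exists (delta_mx 0 a).
Qed.

(** A chain map over multiplication by [u]: [u = 1] compares two resolutions, [u = 0] leads to
    homotopies, and a monomial [u] gives a mapping cone. *)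
Definition chain_lift F G u (phi : forall i, 'M[S]_(rk F i, rk G i)) :=
  phi 0 *m aug G = u *: aug F /\
  forall i, phi i.+1 *m diff G i = diff F i *m phi i.

Lemma chain_lift_exists F G I J u d :
  graded_free_resolution F J -> graded_free_resolution G I ->
  homog_of_degree d u -> (forall p, J p -> I (u * p)) ->
  exists phi, chain_lift u phi /\
    forall i, graded_mx (@gdeg _ _ F i) (@gdeg _ _ G i) d (phi i).
Proof.
move=> [gF eF] [gG eG] hu JI.
have [F0 F1 F2] := eF; have [G0 G1 G2] := eG.
have gu : graded_mx (@gdeg _ _ F 0) (fun=> 0) d (u *: aug F).
  move=> a b; rewrite mxE subr0 addrC; apply: homog_of_degreeM => //.
  by rewrite ord1; apply: gF.1.
have [|phi0 [gphi0 ephi0]] := solve_rows_graded gu (graded_aug gG).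
  move=> v; have [|w hw] := (G0 (u * (v *m aug F) 0 0)).1.
    by apply/JI/F0; exists v.
  exists w; apply/matrixP=> a b; rewrite !ord1 -hw -scalemxAr mxE; congr (u * _).
(* The second clause puts the composite with [diff F i] into the image of [diff G i], so that the
   next matrix can be solved for row by row. *)
pose P i (x : 'M[S]_(rk F i, rk G i)) :=
  graded_mx (@gdeg _ _ F i) (@gdeg _ _ G i) d x /\
  forall v : 'rV_(rk F i.+1), exists w, v *m (diff F i *m x) = w *m diff G i.
pose R i (x : 'M[S]_(rk F i, rk G i)) (y : 'M[S]_(rk F i.+1, rk G i.+1)) :=
  y *m diff G i = diff F i *m x.
have [||phi [phi_0 hP hR]] := @dependent_choice_from _ P R phi0.
- split=> // v; apply/G1.
  by rewrite -!mulmxA ephi0 -!scalemxAr (exact_diff_aug eF) mulmx0 scaler0.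
- move=> i x [gx hx].
  have gdx := graded_mxM (graded_diff (i := i) gF) gx; rewrite add0r in gdx.
  have [y [gy ey]] := solve_rows_graded gdx (graded_diff gG) hx.
  exists y; split=> //; split=> // v; apply/G2.
  by rewrite -!mulmxA ey (mulmxA (diff F _)) (exact_diff_diff _ eF) mul0mx mulmx0.
exists phi; split; last by move=> i; case: (hP i).
by split=> //; rewrite phi_0.
Qed.

Lemma null_homotopy F G I J (phi : forall i, 'M[S]_(rk F i, rk G i)) :
  is_exact F J -> is_exact G I -> chain_lift 0 phi ->
  exists h : forall i, 'M[S]_(rk F i, rk G i.+1),
    phi 0 = h 0 *m diff G 0 /\
    forall i, phi i.+1 = h i.+1 *m diff G i.+1 + diff F i *m h i.
Proof.
move=> eF [_ G1 G2] [phi0 phiS].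
have [|h0 eh0] := @solve_rows _ _ _ _ _ (phi 0) (diff G 0).
  by move=> v; apply/G1; rewrite -mulmxA phi0 scale0r mulmx0.
(* The part of [phi] not yet accounted for by the homotopy consists of cycles of [G], which are
   boundaries by exactness. *)
pose P i (x : 'M[S]_(rk F i, rk G i.+1)) :=
  (phi i.+1 - diff F i *m x) *m diff G i = 0.
pose R i (x : 'M[S]_(rk F i, rk G i.+1)) (y : 'M[S]_(rk F i.+1, rk G i.+2)) :=
  phi i.+1 = y *m diff G i.+1 + diff F i *m x.
have [||h [h_0 hP hR]] := @dependent_choice_from _ P R h0.
- by rewrite /P mulmxBl -mulmxA eh0 phiS subrr.
- move=> i x Px.
  have [|y ey] := @solve_rows _ _ _ _ _ (phi i.+1 - diff F i *m x) (diff G i.+1).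
    by move=> v; apply/G2; rewrite -mulmxA Px mulmx0.
  exists y; rewrite /P /R ey subrK; split=> //.
  rewrite mulmxBl phiS -[X in X *m phi _ - _]mulmx1 -mulmxA mul1mx -mulmxA ey -mulmxBr.
  by rewrite opprB addrCA subrr addr0 mulmxA (exact_diff_diff _ eF) mul0mx.
by exists h; split; rewrite ?h_0.
Qed.

End ChainMaps.

(** * Ranks of subquotients *)

Section SubquotientRank.
Variables (K : fieldType) (r s : nat).

(* The hypotheses say that f induces an injection A / B -> A' / B' with left
   inverse induced by g. *)
Lemma rank_subquotient_le q q' (A : 'M[K]_r) (B : 'M[K]_(q, r)) (A' : 'M[K]_s)
    (B' : 'M[K]_(q', s)) (f : 'M[K]_(r, s)) (g : 'M[K]_(s, r)) :
  (B <= A)%MS -> (B' <= A')%MS -> (A *m f <= A')%MS -> (B' *m g <= B)%MS ->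
  (forall x : 'rV_r, (x <= A)%MS -> (x *m f *m g - x <= B)%MS) ->
  (\rank A - \rank B <= \rank A' - \rank B')%N.
Proof.
(* The complement [C] of [B] in [A] represents the quotient; it remains to see that [f] is injective
   on [C] and that the image of [C] meets [B'] trivially. *)
move=> BA B'A' AfA' B'gB fgB; pose C := (A :\: B)%MS.
have rC : (\rank C = \rank A - \rank B)%N.
  by rewrite -(mxrank_cap_compl A B) (capmx_idPr BA) addKn.
have key (x : 'rV_r) : (x <= C)%MS -> (x *m f <= B')%MS -> x = 0.
  move=> xC xfB'; apply/eqP; rewrite -submx0 -(capmx_diff A B) sub_capmx xC.
  have xA := submx_trans xC (diffmxSl _ _).
  have xfgB : (x *m f *m g <= B)%MS by apply: submx_trans B'gB; apply: submxMr.
  by rewrite -[x](subKr (x *m f *m g)) addmx_sub // eqmx_opp fgB.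
have Cf : \rank (C *m f) = \rank C.
  apply/mxrank_injP; apply/rowV0P=> x; rewrite sub_capmx => /andP[xC /sub_kermxP xf0].
  by apply: key => //; rewrite xf0 sub0mx.
have CfB' : (C *m f :&: B' = 0)%MS.
  apply/eqP/rowV0P=> x; rewrite sub_capmx => /andP[/submxP[y ->] yfB'].
  by rewrite mulmxA in yfB' *; rewrite (key (y *m C)) ?mul0mx ?submxMl.
rewrite -rC leq_subRL ?mxrankS // addnC -Cf -(mxrank_disjoint_sum CfB') mxrankS //.
by rewrite addsmx_sub B'A' andbT (submx_trans (submxMr _ (diffmxSl _ _))).
Qed.

End SubquotientRank.

(** * Independence of the Betti numbers from the resolution *)

Section BettiInvariance.
Variables (K : fieldType) (n : nat).
Notation S := {mpoly K[n]}.
Implicit Types (F G : free_seq K n) (I : S -> Prop).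

Notation mcoeff0 := (map_mx (mcoeff 0%MM : S -> K)).

(** An entry whose row and column have distinct degrees is homogeneous of nonzero degree, so its
    constant term vanishes. Hence the reduced matrix preserves degrees. *)
Lemma tor_proj_comm r s (f : 'I_r -> int) (g : 'I_s -> int) (k : int) (A : 'M[S]_(r, s)) :
  graded_mx f g 0 A ->
  diag_mx (\row_a (f a == k)%:R) *m mcoeff0 A =
  mcoeff0 A *m diag_mx (\row_b (g b == k)%:R).
Proof.
move=> gA; apply/matrixP=> a b; rewrite mul_diag_mx mul_mx_diag !mxE.
have [<-|fg] := eqVneq (f a) (g b); first by rewrite mulrC.
rewrite (homog_mcoeff0 (gA a b)) ?mulr0 ?mul0r //.
by rewrite addr0 subr_eq0.
Qed.

Lemma tor_proj_idem F i k : tor_proj F i k *m tor_proj F i k = tor_proj F i k.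
Proof.
apply/matrixP=> a b; rewrite mul_diag_mx !mxE.
by case: eqP; rewrite ?mul1r ?mul0r ?mul0rn.
Qed.

Lemma sub_tor_proj F i k m (x : 'M_(m, _)) :
  (x <= tor_proj F i k)%MS -> x *m tor_proj F i k = x.
Proof. by case/submxP=> y ->; rewrite -mulmxA tor_proj_idem. Qed.

(** By this inclusion the truncated subtraction in [graded_betti] is a true difference. *)
Lemma tor_boundary_sub F I i k : graded_free_resolution F I ->
  (tor_proj F i.+1 k *m tor_diff F i <= tor_proj F i k :&: tor_cycles F i)%MS.
Proof.
case=> gF eF; rewrite sub_capmx (tor_proj_comm k (graded_diff gF)) submxMl /=.
case: i => [|i] /=; first exact: submx1.
apply/sub_kermxP; rewrite -(tor_proj_comm k (graded_diff gF)) -mulmxA -map_mxM.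
by rewrite (exact_diff_diff _ eF) map_mx0 mulmx0.
Qed.

Lemma chain_lift_cycles F G u phi i m (x : 'M_(m, _)) : @chain_lift K n F G u phi ->
  (x <= tor_cycles F i)%MS -> (x *m mcoeff0 (phi i) <= tor_cycles G i)%MS.
Proof.
case: i x => [|i] x [_ phiS] /=; first by move=> _; rewrite submx1.
move=> /sub_kermxP x0; apply/sub_kermxP.
by rewrite -mulmxA -map_mxM phiS map_mxM mulmxA [x *m _]x0 mul0mx.
Qed.

(** Lifts of the identity in both directions compose to a map homotopic to the identity. After
    reduction, [phi] therefore embeds the homology of [F] in degree [k] into that of [G]. *)
Lemma graded_betti_le F G I i k :
  graded_free_resolution F I -> graded_free_resolution G I ->
  (graded_betti F i k <= graded_betti G i k)%N.
Proof.
move=> rF rG; have [gF eF] := rF; have [gG eG] := rG.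
have h1 : homog_of_degree 0 (1 : S).
  by move=> m; rewrite msupp1 inE => /eqP ->; rewrite mdeg0.
have II p : I p -> I (1 * p) by rewrite mul1r.
have [phi [lphi gphi]] := chain_lift_exists rF rG h1 II.
have [psi [lpsi gpsi]] := chain_lift_exists rG rF h1 II.
have [|h [h0 hS]] := @null_homotopy _ _ F F I I (fun i => phi i *m psi i - 1%:M) eF eF.
  split=> [|j].
    by rewrite mulmxBl -mulmxA lpsi.1 -scalemxAr lphi.1 !scale1r mul1mx subrr scale0r.
  by rewrite mulmxBl mulmxBr -mulmxA lpsi.2 !mulmxA lphi.2 mul1mx mulmx1.
have hom (x : 'rV_(rk F i)) : (x <= tor_cycles F i)%MS ->
    x *m mcoeff0 (phi i) *m mcoeff0 (psi i) - x = x *m mcoeff0 (h i) *m tor_diff F i.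
  move=> xZ; rewrite -[X in _ - X]mulmx1 -mulmxA -map_mxM.
  have <- : mcoeff0 1%:M = 1%:M :> 'M_(rk F i) by rewrite map_mx1.
  rewrite -mulmxBr -map_mxB.
  case: i x xZ => [|i] x /=; first by move=> _; rewrite h0 map_mxM mulmxA.
  move=> /sub_kermxP x0; rewrite hS.
  rewrite map_mxD !map_mxM mulmxDr !mulmxA.
  by rewrite (x0 : x *m mcoeff0 (diff F i) = 0) mul0mx addr0.
apply: (@rank_subquotient_le _ _ _ _ _ _ _ _ _ (mcoeff0 (phi i)) (mcoeff0 (psi i))).
- exact: tor_boundary_sub rF.
- exact: tor_boundary_sub rG.
- rewrite sub_capmx (chain_lift_cycles lphi) ?capmxSr // andbT.
  have /submxP[y ->] := capmxSl (tor_proj F i k) (tor_cycles F i).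
  by rewrite -mulmxA (tor_proj_comm k (gphi i)) mulmxA submxMl.
- rewrite -mulmxA -map_mxM -lpsi.2 map_mxM mulmxA (tor_proj_comm k (gpsi i.+1)).
  by rewrite -mulmxA submxMl.
move=> x; rewrite sub_capmx => /andP[xP xZ]; rewrite hom //.
(* The homotopy is not chosen graded, but by [hom] this boundary is a vector of degree [k], so
   projecting to degree [k] leaves it unchanged. *)
have <- : x *m mcoeff0 (h i) *m tor_diff F i *m tor_proj F i k
        = x *m mcoeff0 (h i) *m tor_diff F i.
  rewrite -hom // mulmxBl -(mulmxA _ _ (tor_proj F i k)) -(tor_proj_comm k (gpsi i)).
  by rewrite mulmxA -(mulmxA x) -(tor_proj_comm k (gphi i)) mulmxA sub_tor_proj.
by rewrite -!mulmxA -(tor_proj_comm k (graded_diff gF)) !mulmxA -mulmxA submxMl.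
Qed.

Lemma graded_betti_unique F G I i k :
  graded_free_resolution F I -> graded_free_resolution G I ->
  graded_betti F i k = graded_betti G i k.
Proof.
move=> rF rG; apply/eqP.
by rewrite eqn_leq (graded_betti_le _ _ rF rG) (graded_betti_le _ _ rG rF).
Qed.

End BettiInvariance.

(** * Mapping cones *)

Section MappingCone.
Variables (K : fieldType) (n : nat).
Notation S := {mpoly K[n]}.
Implicit Types (F G H : free_seq K n) (I J : S -> Prop).

(* The complex H -> S, that is, H shifted by one with S in place 0. *)
Definition aug_rk H i := if i is i'.+1 then rk H i' else 1%N.

Definition aug_gdeg H i : 'I_(aug_rk H i) -> int :=
  match i with 0 => fun=> 0 | i'.+1 => @gdeg _ _ H i' end.

Definition aug_diff H i : 'M[S]_(aug_rk H i.+1, aug_rk H i) :=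
  match i with 0 => aug H | i'.+1 => diff H i' end.

(** If [G] resolves I', [H] resolves J = I' : u and [phi] lifts multiplication by [u], this resolves
    I' + (u): the resolution of S/J, twisted by [d], is glued to that of I'. The minus sign makes
    consecutive differentials compose to zero. *)
Definition cone G H (u : S) d (phi : forall i, 'M[S]_(rk H i, rk G i)) := FreeSeq
  (fun i (a : 'I_(rk G i + aug_rk H i)) =>
     match split a with inl b => gdeg b | inr c => aug_gdeg c + d end)
  (fun i => block_mx (diff G i) 0 (phi i) (- aug_diff H i))
  (col_mx (aug G) u%:M).

Lemma cone_graded G H u d phi :
  is_graded G -> is_graded H -> homog_of_degree d u ->
  (forall i, graded_mx (@gdeg _ _ H i) (@gdeg _ _ G i) d (phi i)) ->
  is_graded (@cone G H u d phi).
Proof.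
move=> gG gH gu gphi; split=> [a|i a b].
  rewrite /= mxE; case: split => c; first exact: gG.1.
  by rewrite ord1 mxE add0r.
rewrite /= mxE; case: split => c; rewrite mxE; case: split => e.
- exact: gG.2.
- by rewrite mxE; apply: homog_of_degree0.
- exact: gphi.
rewrite mxE; apply: homog_of_degreeN.
rewrite opprD addrACA subrr addr0.
case: i {a b} c e => [|i] c e /=; last exact: gH.2.
by rewrite subr0 ord1; apply: gH.1.
Qed.

(** With b = c e1, the vector a + c phi1 is killed by [d0], hence equals w d1, and (w, -c) is the
    required preimage. The matrices are kept abstract so that the augmentation can play the part of
    [d0]. *)
Lemma cone_cycle g0 g1 g2 h0 h1 (d1 : 'M[S]_(g2, g1)) (d0 : 'M[S]_(g1, g0))
    (e1 : 'M[S]_(h1, h0)) (phi1 : 'M[S]_(h1, g1)) (phi0 : 'M[S]_(h0, g0))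
    (a : 'rV_g1) (b : 'rV_h0) :
  phi1 *m d0 = e1 *m phi0 -> (forall v : 'rV_g1, v *m d0 = 0 -> exists w, v = w *m d1) ->
  a *m d0 + b *m phi0 = 0 -> (exists c, b = c *m e1) ->
  exists w, row_mx a b = w *m block_mx d1 0 phi1 (- e1).
Proof.
move=> phi_comm exact_d ab0 [c bE]; have [|w aE] := exact_d (a + c *m phi1).
  by rewrite mulmxDl -mulmxA phi_comm mulmxA -bE.
exists (row_mx w (- c)); rewrite mul_row_block mulmx0 add0r mulmxN !mulNmx opprK -bE.
by rewrite -aE addrK.
Qed.

Lemma cone_exact G H u d phi I I' J :
  is_exact G I' -> is_exact H J -> chain_lift u phi ->
  (forall p, J p <-> I' (u * p)) ->
  (forall p, I p <-> exists q c, I' q /\ p = q + c * u) ->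
  is_exact (@cone G H u d phi) I.
Proof.
move=> eG eH [phi0 phiS] JI' II'.
have [G0 G1 G2] := eG; have [H0 H1 H2] := eH.
have aug_diff2 i : aug_diff H i.+1 *m aug_diff H i = 0.
  by case: i => [|i]; [apply: exact_diff_aug eH | apply: exact_diff_diff eH].
split=> [p|v|i v] /=.
- rewrite II'; split=> [[q [c [/G0[a ->] ->]]]|[v ->]].
    exists (row_mx a c%:M); rewrite mul_row_col [RHS]mxE; congr (_ + _).
    by rewrite mul_scalar_mx !mxE eqxx mulr1n.
  rewrite -[v]hsubmxK mul_row_col [X in exists q c, _ /\ X = _]mxE.
  exists ((lsubmx v *m aug G) 0 0), (rsubmx v 0 0).
  split; first by apply/G0; exists (lsubmx v).
  by congr (_ + _); rewrite mul_mx_scalar mxE mulrC.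
- rewrite -[v]hsubmxK; move: (lsubmx v) (rsubmx v : 'rV_1) => a b {v}.
  split=> [|[w ->]]; last first.
    rewrite -mulmxA mul_block_col mul0mx addr0 (exact_diff_aug eG) phi0.
    by rewrite mulNmx mul_mx_scalar subrr col_mx0 mulmx0.
  rewrite mul_row_col => ab0.
  refine (@cone_cycle _ _ _ _ _ (diff G 0) (aug G) (aug H) (phi 0) u%:M _ _ _ _ ab0 _).
  + by rewrite phi0 mul_mx_scalar.
  + by move=> x /G1.
  (* Here [b] is a scalar with b u in I', so it lies in [J], which is the image of [aug H]. *)
  have [c bc] : exists c : 'rV_(rk H 0), b 0 0 = (c *m aug H) 0 0.
    apply/H0/JI'/G0; exists (- a); rewrite mulNmx.
    move/(canRL (addKr _)): ab0; rewrite addr0 => <-.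
    by rewrite mul_mx_scalar mxE.
  by exists c; apply/matrixP=> x y; rewrite !ord1 bc.
rewrite -[v]hsubmxK; move: (lsubmx v) (rsubmx v) => a b {v}.
split=> [|[w ->]]; last first.
  rewrite -mulmxA mulmx_block !mul0mx !mulmx0 !addr0 (exact_diff_diff _ eG) phiS.
  rewrite mulNmx subrr mulNmx mulmxN opprK add0r.
  by rewrite (aug_diff2 i) block_mx0 mulmx0.
rewrite mul_row_block mulmx0 add0r mulmxN.
rewrite -[0]row_mx0 => /eq_row_mx[ab0 /eqP]; rewrite oppr_eq0 => /eqP b0.
apply: (cone_cycle (d1 := diff G i.+1) (e1 := diff H i) (phi1 := phi i.+1)) ab0 _.
- exact: phiS.
- by move=> x /G2.
by case: i b b0 {a} => [|i] b; [move/H1 | move/H2].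
Qed.

(** In [phi] and in the augmentation of [H], a constant term could only come from an entry of degree
    zero, which the last two hypotheses exclude. *)
Lemma cone_tor_diff G H u d phi i :
  is_graded G -> is_graded H -> homog_of_degree d u ->
  (forall i, graded_mx (@gdeg _ _ H i) (@gdeg _ _ G i) d (phi i)) ->
  tor_diff G i = 0 -> (forall j, tor_diff H j = 0) ->
  (forall a, gdeg (f := H) (i := 0) a != 0) ->
  (forall a b, gdeg (f := H) (i := i) a + d != gdeg (f := G) (i := i) b) ->
  tor_diff (@cone G H u d phi) i = 0.
Proof.
move=> gG gH gu gphi tG tH H0 HG.
rewrite /tor_diff /= map_block_mx [X in block_mx X](tG) map_mx0 map_mxN.
have -> : map_mx (mcoeff 0%MM) (phi i) = 0.
  by apply/matrixP=> a b; rewrite !mxE (homog_mcoeff0 (gphi i a b)) // subr_eq0.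
have -> : map_mx (mcoeff 0%MM) (aug_diff H i) = 0.
  case: i {tG HG} => [|i]; last exact: tH.
  by apply/matrixP=> a b; rewrite !mxE ord1 (homog_mcoeff0 (gH.1 a)).
by rewrite oppr0 block_mx0.
Qed.

Lemma cone_tor_proj G H u d phi i k :
  \rank (tor_proj (@cone G H u d phi) i k) =
  (\rank (tor_proj G i k) +
   if i is i'.+1 then \rank (tor_proj H i' (k - d)) else d == k)%N.
Proof.
rewrite /tor_proj /=.
set r := (X in diag_mx X).
have -> : r = row_mx (\row_a (gdeg a == k)%:R) (\row_c (aug_gdeg c + d == k)%:R).
  by apply/rowP=> a; rewrite !mxE; case: split => b; rewrite mxE.
rewrite diag_mx_row rank_diag_block_mx; congr (_ + _)%N.
case: i {r} => [|i] /=; last first.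
  by congr (\rank (diag_mx _)); apply/rowP=> a; rewrite !mxE eq_sym -subr_eq eq_sym.
have [dk|dk] := eqVneq d k.
  have -> : diag_mx (\row__ (0 + d == k)%:R) = 1%:M :> 'M[K]_1.
    by apply/matrixP=> a b; rewrite !ord1 !mxE add0r dk !eqxx.
  by rewrite mxrank1.
have -> : diag_mx (\row__ (0 + d == k)%:R) = 0 :> 'M[K]_1.
  by apply/matrixP=> a b; rewrite !ord1 !mxE add0r (negPf dk).
by rewrite mxrank0.
Qed.

Lemma tor_proj_neq0 F i k a : gdeg (f := F) (i := i) a = k -> \rank (tor_proj F i k) != 0%N.
Proof.
move=> ak; rewrite mxrank_eq0; apply/eqP => /matrixP /(_ a a).
by rewrite !mxE ak !eqxx; apply/eqP/oner_neq0.
Qed.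

End MappingCone.

(** * Minimal resolutions of ideals with linear quotients *)

Section LinearQuotients.
Variables (K : fieldType) (n : nat).
Notation S := {mpoly K[n]}.
Implicit Types (F G H : free_seq K n) (I J : S -> Prop) (P Q : pred 'X_{1..n}).

(** Vanishing of the reduced differentials is minimality, and the rank of the projector counts the
    basis elements of degree [k] in place [i]. *)
Definition minimally_resolved I (beta : nat -> int -> nat) :=
  exists F, [/\ graded_free_resolution F I, forall i, tor_diff F i = 0
    & forall i k, \rank (tor_proj F i k) = beta i k].

Lemma graded_betti_minimal I beta F i k :
  minimally_resolved I beta -> graded_free_resolution F I ->
  graded_betti F i k = beta i k.
Proof.
move=> [G [rG tG bG]] rF; rewrite (graded_betti_unique i k rF rG) -bG.
rewrite /graded_betti tG mulmx0 mxrank0 subn0.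
apply/eqmx_rank/eqmxP/capmx_idPl.
by case: i => [|i] /=; [exact: submx1 | apply/sub_kermxP; rewrite tG mulmx0].
Qed.

(** The last two hypotheses leave no room for units in the new blocks of the cone, so it stays
    minimal and the ranks add up. *)
Lemma minimally_resolved_cone I I' J (u : 'X_{1..n}) beta gamma :
  minimally_resolved I' beta -> minimally_resolved J gamma ->
  (forall p, J p <-> I' ('X_[u] * p)) ->
  (forall p, I p <-> exists q c, I' q /\ p = q + c * 'X_[u]) ->
  gamma 0%N 0 = 0%N ->
  (forall i k, gamma i (k - (mdeg u)%:Z) != 0%N -> beta i k = 0%N) ->
  minimally_resolved I (fun i k => beta i k +
    if i is i'.+1 then gamma i' (k - (mdeg u)%:Z)%R else ((mdeg u)%:Z == k))%N.
Proof.
move=> [G [[gG eG] tG bG]] [H [[gH eH] tH bH]] JI' II' gamma0 gamma_beta.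
have hu := @homog_of_degreeX K n u.
have [|phi [lphi gphi]] := chain_lift_exists (conj gH eH) (conj gG eG) hu.
  by move=> p /JI'.
exists (@cone _ _ G H 'X_[u] (mdeg u)%:Z phi); split.
  split; first exact: cone_graded.
  exact: (cone_exact _ eG eH lphi JI' II').
- move=> i; apply: cone_tor_diff => //.
    by move=> a; apply/eqP=> /tor_proj_neq0; rewrite bH gamma0.
  move=> a b; apply/eqP=> ab; have := tor_proj_neq0 (esym ab).
  by rewrite bG gamma_beta // -bH; apply: (@tor_proj_neq0 _ _ _ _ _ a); rewrite addrK.
- by move=> i k; rewrite cone_tor_proj bG; case: i => // i; rewrite bH.
Qed.

Lemma minimally_resolved_ext I J beta gamma :
  minimally_resolved I beta -> (forall p, I p <-> J p) ->
  (forall i k, beta i k = gamma i k) -> minimally_resolved J gamma.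
Proof.
move=> [F [[gF [F0 F1 F2]] tF bF]] IJ bg; exists F; split=> //.
  by split=> //; split=> // p; rewrite -IJ.
by move=> i k; rewrite bF.
Qed.

(** A monomial ideal encoded by a boolean test on monomials; this is an ideal as soon as [P] passes
    to multiples. *)
Definition mideal P : S -> Prop := fun p => all P (msupp p).

Lemma eq_mideal P Q p : P =1 Q -> mideal P p <-> mideal Q p.
Proof. by move=> PQ; rewrite /mideal (eq_all PQ). Qed.

Lemma mideal_colon P Q u :
  (forall m, Q m = P (m + u)%MM) -> forall p, mideal Q p <-> mideal P ('X_[u] * p).
Proof.
move=> QP p; suff E : all Q (msupp p) = all P (msupp ('X_[u] * p)) by rewrite /mideal E.
rewrite mulrC (perm_all _ (msuppMX _ _)) [RHS]all_map.
by apply: eq_all => m; rewrite /= QP addmC.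
Qed.

Lemma mideal_add P Q u : (forall m, Q m = P m || (u <= m)%MM) ->
  forall p, mideal Q p <-> exists q c, mideal P q /\ p = q + c * 'X_[u].
Proof.
move=> QP p; split=> [Qp|[q [c [Pq ->]]]]; last first.
  apply/allP => m /msuppD_le; rewrite mem_cat QP => /orP[/(allP Pq) -> //|].
  by rewrite (perm_mem (msuppMX _ _)) => /mapP[m' _ ->]; rewrite lem_addr orbT.
exists (\sum_(m <- msupp p | P m) p@_m *: 'X_[m]).
exists (\sum_(m <- msupp p | ~~ P m) p@_m *: 'X_[m - u]); split.
  apply/allP=> m /msupp_sum_le /flatten_mapP[m']; rewrite mem_filter => /andP[Pm' _].
  by move=> /msuppZ_le; rewrite msuppX inE => /eqP ->.
rewrite {1}[p]mpolyE (bigID P) /=; congr (_ + _); rewrite mulr_suml.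
rewrite big_seq_cond [RHS]big_seq_cond; apply: eq_bigr => m /andP[m_p nPm].
by rewrite -scalerAl -mpolyXD submK //; move: (allP Qp _ m_p); rewrite QP (negPf nPm).
Qed.

Lemma minimally_resolved0 : minimally_resolved (mideal xpred0) (fun _ _ => 0%N).
Proof.
exists (@FreeSeq K n (fun=> 0%N) (fun _ _ => 0) (fun=> 0) 0); split.
- split; first by split=> [[]|? []].
  split=> [p|v|i v] /=.
  + rewrite /mideal; split=> [|[v ->]]; last by rewrite mulmx0 mxE msupp0.
    case E: (msupp p) => [|//] _; exists 0.
    by rewrite mul0mx mxE; apply/eqP; rewrite -msupp_eq0 E.
  + by split=> _; [exists 0; rewrite !thinmx0 | rewrite mulmx0].
  + by split=> _; [exists 0; rewrite !thinmx0 | rewrite mulmx0].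
- by move=> i; rewrite flatmx0.
- by move=> i k; rewrite [tor_proj _ _ _]flatmx0 mxrank0.
Qed.

(** This is the Koszul complex, built one variable at a time. A variable outside [s] is a
    nonzerodivisor modulo the ideal of [s], so the colon ideal is that ideal itself and [rs] enters
    the cone twice; Pascal's rule gives the binomials. The ideal is resolved and not the quotient,
    hence the shift to [i.+1]. *)
Lemma minimally_resolved_variables (s : seq 'I_n) : uniq s ->
  minimally_resolved (mideal (fun m => has (fun j => 0 < m j)%N s))
    (fun i k => (k == i.+1%:Z) * 'C(size s, i.+1))%N.
Proof.
elim: s => [_|x s IHs /= /andP[x_s s_uniq]].
  by apply: minimally_resolved_ext minimally_resolved0 _ _ => [//|i k]; rewrite muln0.
have rs := IHs s_uniq; set P := (X in mideal X) in rs.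
have colon m : P m = P (m + U_(x))%MM.
  apply: eq_in_has => j j_s; rewrite mnmDE mnm1E.
  by case: eqP => [xj|_]; [rewrite xj j_s in x_s | rewrite addn0].
apply: minimally_resolved_ext
  (minimally_resolved_cone rs rs (mideal_colon colon) (mideal_add (fun=> erefl)) _ _) _ _.
- by [].
- by move=> i k; rewrite mdeg1; case: eqP => //= kE; case: eqP => // kE'; lia.
- move=> p; apply: eq_mideal => m /=.
  rewrite orbC; congr (_ || _); apply/mnm_lepP/idP => [/(_ x)|mx j].
    by rewrite mnm1E eqxx.
  by rewrite mnm1E; case: eqP => // <-.
move=> i k; rewrite binS mulnDr mdeg1; congr (_ + _)%N.
case: i => [|i]; first by rewrite bin0 muln1 eq_sym.
by congr ((nat_of_bool _) * _)%N; apply/eqP/eqP; lia.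
Qed.

(* Generators are listed in the reverse of the usual order: the colon ideal at u is
   that of the entries after u. *)
Definition linear_quotients (us : seq 'X_{1..n}) (A : 'X_{1..n} -> {set 'I_n}) :=
  forall us1 u us2, us = us1 ++ u :: us2 ->
    (forall m, has (fun g => g <= m + u)%MM us2 = [exists j in A u, 0 < m j]%N) /\
    all (fun g => mdeg g <= mdeg u)%N us2.

Lemma minimally_resolved_linear_quotients us A : linear_quotients us A ->
  minimally_resolved (mideal (fun m => has (fun g => g <= m)%MM us))
    (fun i k => \sum_(u <- us) (k == (i + mdeg u)%:Z) * 'C(#|A u|, i))%N.
Proof.
elim: us => [_|u us IHus lq].
  by apply: minimally_resolved_ext minimally_resolved0 _ _ => [//|i k]; rewrite big_nil.
have [colon us_deg] := lq [::] u us erefl.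
have rI : minimally_resolved _ _ := IHus _.
have rJ := minimally_resolved_variables (enum_uniq (mem (A u))).
apply: minimally_resolved_ext
  (minimally_resolved_cone (u := u) (rI _) rJ (mideal_colon _)
     (mideal_add (fun=> erefl)) _ _) _ _.
- by move=> us1 v us2 usE; apply: (lq (u :: us1)); rewrite usE.
- move=> m /=; rewrite [RHS]colon.
  apply/hasP/existsP => [[j jA mj]|[j /andP[jA mj]]]; exists j => //.
    by rewrite mem_enum in jA; rewrite jA.
  by rewrite mem_enum.
- by [].
(* After the twist, a Koszul basis element of place [i] has degree i + 1 + deg u, more than i + deg
   v for every later generator [v]. *)
- move=> i k; case: eqP => // ku _; rewrite big_seq big1 // => v /(allP us_deg) vu.
  by case: eqP => // kv; lia.
- by move=> p; apply: eq_mideal => m /=; rewrite orbC.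
move=> i k; rewrite big_cons addnC; congr (_ + _)%N.
case: i => [|i]; first by rewrite bin0 muln1 eq_sym add0n.
by rewrite -cardE; congr ((nat_of_bool _) * _)%N; apply/eqP/eqP; lia.
Qed.

End LinearQuotients.

(** * Minimal generators of monomial ideals *)

Section MonomialIdeals.
Variables (K : fieldType) (n : nat).
Notation S := {mpoly K[n]}.
Implicit Types (I : S -> Prop) (A G : 'X_{1..n} -> Prop) (u v m : 'X_{1..n}).

Lemma monomial_idealP A (p : S) :
  monomial_ideal A p <-> forall m, m \in msupp p -> exists a, A a /\ (a <= m)%MM.
Proof.
split=> [[s [As ->]] m /msupp_sum_le /flatten_mapP[q]|pA].
  rewrite mem_filter /= => q_s; rewrite (perm_mem (msuppMX _ _)) => /mapP[m' _ ->].
  by exists q.2; split; [apply: As | rewrite lem_addr].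
suff [s [As sE]] : exists s : seq (S * 'X_{1..n}), (forall q, q \in s -> A q.2) /\
    \sum_(m <- msupp p) p@_m *: 'X_[m] = \sum_(q <- s) q.1 * 'X_[q.2].
  by exists s; split; rewrite // {1}[p]mpolyE.
elim: (msupp p : seq _) pA => [|m r IHr] rA.
  by exists [::]; split; rewrite ?big_nil.
have [|s [As sE]] := IHr; first by move=> m' m'_r; apply: rA; rewrite inE m'_r orbT.
have [|a [Aa am]] := rA m; first by rewrite inE eqxx.
exists ((p@_m *: 'X_[m - a], a) :: s); split=> [q|]; last first.
  by rewrite !big_cons sE /= -scalerAl -mpolyXD submK.
by rewrite inE => /orP[/eqP -> //|/As].
Qed.

Lemma generatesX A I m : generates A I -> I 'X_[m] <-> exists a, A a /\ (a <= m)%MM.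
Proof.
move=> AI; rewrite AI monomial_idealP msuppX; split=> [|Am m']; first by apply; rewrite inE.
by rewrite inE => /eqP ->.
Qed.

Lemma generates_msupp A I p : generates A I -> I p <-> forall m, m \in msupp p -> I 'X_[m].
Proof.
move=> AI; rewrite AI monomial_idealP.
by split=> Ip m /Ip /(generatesX m AI).
Qed.

Lemma generatesP A G I : generates A I ->
  generates G I <-> forall m, I 'X_[m] <-> exists a, G a /\ (a <= m)%MM.
Proof.
move=> AI; split=> [GI m|GI p]; first exact: generatesX.
by rewrite (generates_msupp p AI) monomial_idealP; split=> Ip m /Ip /GI.
Qed.

(** A form of [mingens] that does not quantify over generating sets; the two agree on monomial
    ideals by [mingensP]. *)
Definition minimal_monomial I u :=
  I 'X_[u] /\ forall v, I 'X_[v] -> (v <= u)%MM -> v = u.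

Lemma lem_mdeg_eq u v : (u <= v)%MM -> (mdeg v <= mdeg u)%N -> u = v.
Proof.
move=> /submK; move: (v - u)%MM => w <-; rewrite mdegD -[leqRHS]add0n leq_add2r leqn0.
by rewrite mdeg_eq0 => /eqP ->; rewrite add0m.
Qed.

Lemma lem_mdeg u v : (u <= v)%MM -> (mdeg u <= mdeg v)%N.
Proof. by move=> uv; rewrite -(submK uv) mdegD leq_addl. Qed.

Lemma exists_minimal_monomial I m :
  I 'X_[m] -> exists u, minimal_monomial I u /\ (u <= m)%MM.
Proof.
elim: {m}(mdeg m) {-2}m (leqnn (mdeg m)) => [|d IHd] m md Im.
  by exists m; split; rewrite ?lepm_refl //; split=> // v _ /lem_mdeg_eq; apply; lia.
have [[v [Iv vm]]|nv] :=
    classic (exists v, I 'X_[v] /\ ((v <= m)%MM && (mdeg v < mdeg m)%N)).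
  case/andP: vm => vm vm_deg; have [|u [Mu uv]] := IHd v _ Iv; first by lia.
  by exists u; split=> //; apply: lepm_trans uv vm.
exists m; split; rewrite ?lepm_refl //; split=> // v Iv vm.
apply: lem_mdeg_eq => //; rewrite leqNgt; apply/negP=> vm_deg.
by apply: nv; exists v; rewrite vm.
Qed.

(** The minimal monomials generate [I] and belong to every generating set, so they form the only
    minimal one. *)
Lemma mingensP A I u : generates A I -> mingens I u <-> minimal_monomial I u.
Proof.
move=> AI.
have Mgen : generates (minimal_monomial I) I.
  apply/(generatesP _ AI) => m; split=> [/exists_minimal_monomial //|[v [[Iv _] vm]]].
  have /(generatesX _ AI)[a [Aa av]] := Iv.
  by apply/(generatesX _ AI); exists a; split=> //; apply: lepm_trans av vm.
have Mle G : generates G I -> forall v, minimal_monomial I v -> G v.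
  move=> GI v [Iv vmin]; have /(generatesX _ GI)[a [Ga av]] := Iv.
  by rewrite -(vmin a) //; apply/(generatesX _ GI); exists a; rewrite lepm_refl.
split=> [[G [[GI Gmin] Gu]]|Mu]; first exact: (Gmin _ (Mle _ GI)).
exists (minimal_monomial I); split=> //; split=> // B _ BI.
exact: Mle.
Qed.

Lemma mem_filter_prop (T : eqType) (P : T -> Prop) (s : seq T) :
  exists r : seq T, uniq r /\ forall x, x \in r <-> x \in s /\ P x.
Proof.
elim: s => [|y s [r [r_uniq rP]]]; first by exists [::]; split=> // x; split=> [|[]].
have [yr|yr] := boolP (y \in r).
  exists r; split=> // x; rewrite inE rP; split=> [[-> Px]|[/orP[/eqP ->|xs] Px]] //.
    by rewrite orbT.
  by have /rP := yr.
have [Py|nPy] := classic (P y).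
  exists (y :: r); split=> [|x] /=; first by rewrite yr.
  rewrite !inE; split=> [/orP[/eqP ->|/rP[-> Px]]|[/orP[->//|xs] Px]].
  - by rewrite eqxx.
  - by rewrite orbT.
  - by rewrite orbC; apply/orP; left; apply/rP.
exists r; split=> // x; rewrite inE rP; split=> [[-> Px]|[/orP[/eqP ->|xs] Px]] //.
by rewrite orbT.
Qed.

(** Finiteness is read off the finite rank of [F] in place 0: a minimal generator is a multiple of a
    monomial occurring in some entry of [aug F]; that monomial lies in [I], so the two coincide. *)
Lemma mingens_finite A I (F : free_seq K n) : generates A I -> is_exact F I ->
  exists gs : seq 'X_{1..n}, uniq gs /\ forall u, u \in gs <-> mingens I u.
Proof.
move=> AI [F0 _ _].
have [gs [gs_uniq gsP]] := mem_filter_prop (minimal_monomial I)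
  (flatten [seq msupp (aug F a 0) | a <- enum 'I_(rk F 0)]).
exists gs; split=> // u; rewrite gsP (mingensP _ AI); split=> [[]//|Mu]; split=> //.
have [/F0[v Xu] umin] := Mu.
have : u \in msupp ('X_[u] : S) by rewrite msuppX inE.
rewrite Xu mxE => /msupp_sum_le /flatten_mapP[a _].
move=> /msuppM_le /allpairsP[[m1 m2] /= [_ m2a uE]].
have Ia : I (aug F a 0) by apply/F0; exists (delta_mx 0 a); rewrite -rowE mxE.
apply/flatten_mapP; exists a; first by rewrite mem_enum.
by rewrite -(umin m2) // ?uE ?lem_addl //; move/(generates_msupp _ AI): Ia; apply.
Qed.

End MonomialIdeals.

(** * Combinatorics of spread sequences *)

Section SpreadSequences.
Local Open Scope nat_scope.
Implicit Types (t lo : nat) (s u v w : seq nat).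

Fixpoint spread t lo s :=
  if s is a :: s' then (lo <= a) && spread t (a + t) s' else true.

Lemma spread_sorted t s : sorted (fun a b => a + t <= b) s = spread t 0 s.
Proof.
by case: s => //= a s; elim: s a => //= b s IHs a; rewrite IHs.
Qed.

Lemma spread_le t t' lo lo' s : t' <= t -> lo' <= lo -> spread t lo s -> spread t' lo' s.
Proof.
move=> tt'; elim: s lo lo' => //= a s IHs lo lo' lolo' /andP[loa /IHs ->]; lia.
Qed.

Lemma spread_ge t lo s : spread t lo s -> all (leq lo) s.
Proof.
elim: s lo => //= a s IHs lo /andP[loa /IHs sa]; rewrite loa /=.
by apply: sub_all sa => b; lia.
Qed.

(** The fold is the bound in force after [s]: its last term plus [t], or [lo] if [s] is empty. *)
Lemma spread_cat t lo s s' :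
  spread t lo (s ++ s') = spread t lo s && spread t (foldl (fun _ a => a + t) lo s) s'.
Proof. by elim: s lo => //= a s IHs lo; rewrite IHs andbA. Qed.

Lemma spread_take t lo k s : spread t lo s -> spread t lo (take k s).
Proof. by rewrite -{1}(cat_take_drop k s) spread_cat => /andP[]. Qed.

(** Counting terms up to the head of [u] shows that the head of [w] is no larger; removing both
    heads preserves the comparison of counts. *)
Lemma all2_take_leq lo lo' u w : spread 0 lo u -> spread 0 lo' w ->
  (forall x, count (fun a => a <= x) u <= count (fun a => a <= x) w) ->
  all2 leq (take (size u) w) u.
Proof.
elim: u w lo lo' => [|a u IHu] w lo lo'; first by rewrite take0.
case: w => [|b w] /=; first by move=> _ _ /(_ a); rewrite leqnn.
rewrite !addn0 => /andP[_ su] /andP[_ sw] uw.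
have ba : b <= a.
  rewrite leqNgt; apply/negP=> ab; move: (uw a); rewrite leqnn (leqNgt b) ab /=.
  suff -> : count (fun x => x <= a) w = 0 by [].
  apply/eqP; rewrite -leqn0 leqNgt -has_count -all_predC.
  by apply: sub_all (spread_ge sw) => x /=; lia.
rewrite ba /=; apply: (IHu _ _ _ su sw) => x.
have [ax|xa] := leqP a x; first by move: (uw x); rewrite ax (leq_trans ba ax) leq_add2l.
suff -> : count (fun y => y <= x) u = 0 by [].
apply/eqP; rewrite -leqn0 leqNgt -has_count -all_predC.
by apply: sub_all (spread_ge su) => y /=; lia.
Qed.

Lemma all2_leq_trans u v w : all2 leq u v -> all2 leq v w -> all2 leq u w.
Proof.
elim: u v w => [|a u IHu] [|b v] [|c w] //= /andP[ab uv] /andP[bc vw].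
by rewrite (leq_trans ab bc) (IHu v).
Qed.

Lemma all2_leq_take k u v : all2 leq u v -> all2 leq (take k u) (take k v).
Proof. by elim: k u v => [|k IHk] [|a u] [|b v] //= /andP[-> /IHk]. Qed.

Lemma all2_leq_lt n u v : all2 leq u v -> all (fun a => a < n) v -> all (fun a => a < n) u.
Proof.
elim: u v => [|a u IHu] [|b v] //= /andP[ab /IHu uv] /andP[bn /uv ->].
by rewrite (leq_ltn_trans ab).
Qed.

Lemma all2_leq_sumn u v : all2 leq u v -> sumn v <= sumn u -> u = v.
Proof.
elim: u v => [|a u IHu] [|b v] //= /andP[ab uv].
have le_sumn : sumn u <= sumn v.
  by elim: u v uv {IHu} => [|c u IHu] [|d v] //= /andP[cd /IHu]; lia.
by move=> le; rewrite (IHu v) //; [congr (_ :: _) | ]; lia.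
Qed.

(* The terms by which some term of s can be replaced, lowering it, so that the
   sequence remains t-spread with terms at least lo. *)
Fixpoint gaps t lo s :=
  if s is a :: s' then iota lo (a - lo) ++ gaps t (a + t) s' else [::].

Lemma gaps_replace t lo s i : spread t lo s -> i \in gaps t lo s ->
  exists s1 j s2, [/\ s = s1 ++ j :: s2, i < j & spread t lo (s1 ++ i :: s2)].
Proof.
elim: s lo => //= a s IHs lo /andP[loa sa].
rewrite mem_cat mem_iota => /orP[ia|/(IHs _ sa)[s1 [j [s2 [-> ij sp]]]]].
  exists [::], a, s; split=> //=; first by lia.
  by apply/andP; split; [lia | apply: spread_le sa => //; lia].
by exists (a :: s1), j, s2; split=> //=; rewrite loa.
Qed.

Lemma gaps_ge t lo s i : spread t lo s -> i \in gaps t lo s -> lo <= i.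
Proof.
move=> ss /(gaps_replace ss)[s1 [j [s2 [_ _ /spread_ge/allP]]]].
by apply; rewrite mem_cat inE eqxx orbT.
Qed.

Lemma gaps_lt t lo s i n :
  spread t lo s -> all (fun a => a < n) s -> i \in gaps t lo s -> i < n.
Proof.
move=> ss sn /(gaps_replace ss)[s1 [j [s2 [sE ij _]]]]; apply: (ltn_trans ij).
by apply: (allP sn); rewrite sE mem_cat inE eqxx orbT.
Qed.

Lemma gaps_uniq t lo s : spread t lo s -> uniq (gaps t lo s).
Proof.
elim: s lo => //= a s IHs lo /andP[loa sa].
rewrite cat_uniq iota_uniq IHs // andbT /=; apply/hasPn=> i /(gaps_ge sa).
by rewrite mem_iota; lia.
Qed.

(** At the first place where the term [b] of [v] is below the term [a] of [u], [b] lies in the gap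
    before [a] and does not occur in the rest of [u]. For monomials, the second alternative gives a
    variable dividing every cofactor that turns [u] into a multiple of [v]. *)
Lemma gaps_or_all2_leq t lo u v : spread t lo u -> spread t lo v -> size v <= size u ->
  all2 leq (take (size v) u) v \/
  exists2 i, i \in gaps t lo u & count_mem i u < count_mem i v.
Proof.
elim: u v lo => [|a u IHu] [|b v] lo //=; try by left.
move=> /andP[loa su] /andP[lob sv]; rewrite ltnS => vu.
have [ab|ba] := leqP a b; last first.
  right; exists b; first by rewrite mem_cat mem_iota; lia.
  rewrite eqxx; case: eqP => [|_]; first by lia.
  rewrite (_ : count_mem b u = 0) //; apply/count_memPn/negP=> /(allP (spread_ge su)).
  by lia.
have [|uv|[i iu iuv]] := IHu v (a + t) su _ vu; [|by left; rewrite /= uv|].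
  by apply: spread_le sv => //; lia.
right; exists i; first by rewrite mem_cat iu orbT.
have iv : i \in v by rewrite -has_pred1 has_count; lia.
(* If [a = i], then b + t <= a <= b, so [b = i] as well, and the two heads do not upset the
   counts. *)
have bi : b + t <= i := allP (spread_ge sv) _ iv; have ai := gaps_ge su iu.
by move: iuv; rewrite -(ltn_add2l (a == i)) => /leq_trans; apply; rewrite leq_add2r; lia.
Qed.

(** The map sigma on index sequences, with the position [c] of the head as a counter. *)
Fixpoint shift c s := if s is a :: s' then (a + c) :: shift c.+1 s' else [::].

Fixpoint unshift c s := if s is a :: s' then (a - c) :: unshift c.+1 s' else [::].

Lemma size_shift c s : size (shift c s) = size s.
Proof. by elim: s c => //= a s IHs c; rewrite IHs. Qed.

Lemma shiftE s : mkseq (fun j => nth 0 s j + j) (size s) = shift 0 s.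
Proof.
suff gen c : [seq nth 0 s j + (c + j) | j <- iota 0 (size s)] = shift c s by exact: gen 0.
elim: s c => //= a s IHs c; rewrite addn0; congr (_ :: _).
rewrite -IHs -[1]addn0 iotaDl -map_comp.
by apply: eq_map => j /=; rewrite addnS.
Qed.

Lemma spread_shift t lo c s : spread t lo s -> spread t.+1 (lo + c) (shift c s).
Proof.
elim: s lo c => //= a s IHs lo c /andP[loa sa]; rewrite leq_add2r loa /=.
by have := IHs _ c.+1 sa; rewrite addnAC -addnA addSnnS addnA.
Qed.

Lemma take_shift k c s : take k (shift c s) = shift c (take k s).
Proof. by elim: k c s => [|k IHk] c [|a s] //=; rewrite IHk. Qed.

Lemma all2_leq_shift c s s' : all2 leq (shift c s) (shift c s') = all2 leq s s'.
Proof. by elim: s s' c => [|a s IHs] [|b s'] c //=; rewrite leq_add2r IHs. Qed.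

Lemma shift_inj c : injective (shift c).
Proof.
move=> s s'; elim: s s' c => [|a s IHs] [|b s'] c //= [/eqP].
by rewrite eqn_add2r => /eqP -> /IHs ->.
Qed.

(** The gap before a term in position [c] moves by [c] at both ends, since the next bound a + c + t
    + 1 equals (a + t) + (c + 1). This is what yields q(sigma(u)) = q(u). *)
Lemma size_gaps_shift t lo c s : size (gaps t.+1 (lo + c) (shift c s)) = size (gaps t lo s).
Proof.
elim: s lo c => //= a s IHs lo c; rewrite !size_cat !size_iota subnDr -(IHs _ c.+1).
by rewrite addnAC -addnA addSnnS addnA.
Qed.

(** The spread hypothesis bounds the head below by [c], so that a - c is not truncated. *)
Lemma unshiftK t lo c s : spread t.+1 (lo + c) s -> shift c (unshift c s) = s.
Proof.
elim: s lo c => //= a s IHs lo c /andP[loa sa].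
rewrite subnK; last by lia.
by rewrite (IHs (a - c + t)) //; apply: spread_le sa => //; lia.
Qed.

Lemma spread_unshift t lo c s : spread t.+1 (lo + c) s -> spread t lo (unshift c s).
Proof.
elim: s lo c => //= a s IHs lo c /andP[loa sa]; apply/andP; split; first by lia.
by apply: IHs; apply: spread_le sa => //; lia.
Qed.

End SpreadSequences.

(** * Monomials and their index sequences *)

Section Indices.
Local Open Scope nat_scope.
Variable n : nat.
Implicit Types (m u v : 'X_{1..n}) (s : seq nat).

(** Inverse to [mon_indices] on sorted sequences with terms below [n]; larger terms are dropped. *)
Definition mono s : 'X_{1..n} := [multinom count_mem (i : nat) s | i < n].

Lemma count_mon_indices (P : pred nat) m :
  count P (mon_indices m) = \sum_(i < n) P i * m i.
Proof.
rewrite /mon_indices count_flatten -map_comp sumnE big_map big_enum /=.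
by apply: eq_bigr => i _; rewrite count_nseq.
Qed.

Lemma size_mon_indices m : size (mon_indices m) = mdeg m.
Proof.
rewrite -count_predT count_mon_indices mdegE.
by apply: eq_bigr => i _; rewrite mul1n.
Qed.

Lemma count_mem_mon_indices m (i : 'I_n) : count_mem (i : nat) (mon_indices m) = m i.
Proof.
rewrite count_mon_indices (bigD1 i) //= eqxx mul1n big1 ?addn0 // => j /negPf ji.
by rewrite (_ : (j == i :> nat) = false).
Qed.

Lemma mon_indices_lt m : all (fun a => a < n) (mon_indices m).
Proof.
by apply/allP=> a /flatten_mapP[i _]; rewrite mem_nseq => /andP[_ /eqP ->].
Qed.

Lemma mon_indicesK : cancel (@mon_indices n) mono.
Proof. by move=> m; apply/mnmP => i; rewrite mnmE count_mem_mon_indices. Qed.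

Lemma mon_indices_sorted m : sorted leq (mon_indices m).
Proof.
(* Extending the exponents to all naturals replaces [enum 'I_n] by an interval, over which one can
   induct. *)
pose f k := if insub k is Some i then m i else 0.
have -> : mon_indices m = flatten [seq nseq (f k) k | k <- iota 0 n].
  rewrite -val_enum_ord -map_comp; congr flatten; apply: eq_map => i /=.
  by rewrite /f valK.
elim: n 0 => [|k IHk] lo //=.
have lo_le : all (leq lo) (flatten [seq nseq (f k0) k0 | k0 <- iota lo.+1 k]).
  apply/allP=> a /flatten_mapP[b]; rewrite mem_iota => /andP[lob _].
  by rewrite mem_nseq => /andP[_ /eqP ->]; apply: ltnW.
elim: (f lo) => //= c IHc; rewrite path_min_sorted //.
by rewrite all_cat lo_le andbT; apply/allP=> a; rewrite mem_nseq => /andP[_ /eqP ->].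
Qed.

Lemma spread_mon_indices m : spread 0 0 (mon_indices m).
Proof.
rewrite -spread_sorted (eq_sorted (e' := leq)) ?mon_indices_sorted // => a b.
by rewrite addn0.
Qed.

Lemma monoK t s : spread t 0 s -> all (fun a => a < n) s -> mon_indices (mono s) = s.
Proof.
move=> ss sn; apply: (sorted_eq leq_trans anti_leq (mon_indices_sorted _)).
  have : spread 0 0 s by apply: spread_le ss.
  by rewrite -spread_sorted (eq_sorted (e' := leq)) // => a b; rewrite addn0.
apply/allP=> a _ /=; apply/eqP.
have [an|na] := ltnP a n; first by rewrite (count_mem_mon_indices _ (Ordinal an)) mnmE.
rewrite !(count_memPn _) //; apply/negP=> /allP; last by move/(_ _ (mon_indices_lt _)); lia.
by move/(_ _ sn); lia.
Qed.

Lemma mdeg_mono t s : spread t 0 s -> all (fun a => a < n) s -> mdeg (mono s) = size s.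
Proof. by move=> ss sn; rewrite -size_mon_indices (monoK ss sn). Qed.

Lemma lem_mono_take k s : (mono (take k s) <= mono s)%MM.
Proof.
by apply/mnm_lepP=> i; rewrite !mnmE -{2}(cat_take_drop k s) count_cat leq_addr.
Qed.

Lemma mono_replace s1 s2 (i j : 'I_n) :
  (mono (s1 ++ val j :: s2) - U_(j) + U_(i))%MM = mono (s1 ++ val i :: s2).
Proof.
apply/mnmP=> k; rewrite !mnmE !count_cat /= -!val_eqE.
by rewrite [RHS]addnCA [in LHS]addnCA addKn addnC.
Qed.

(** A multiple has at least as many indices up to any bound, so its smallest indices are termwise no
    larger. *)
Lemma all2_take_mon_indices u v : (u <= v)%MM ->
  all2 leq (take (mdeg u) (mon_indices v)) (mon_indices u).
Proof.
move=> /mnm_lepP uv; rewrite -size_mon_indices.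
apply: (all2_take_leq (spread_mon_indices u) (spread_mon_indices v)) => x.
by rewrite !count_mon_indices leq_sum // => i _; rewrite leq_mul2l uv orbT.
Qed.

Lemma all2_mon_indices_lower u (i j : 'I_n) : i < j -> 0 < u j ->
  all2 leq (mon_indices (u - U_(j) + U_(i))%MM) (mon_indices u).
Proof.
move=> ij uj; set v := (u - U_(j) + U_(i))%MM.
have uE : (u - U_(j) + U_(j))%MM = u.
  by apply: submK; apply/mnm_lepP=> k; rewrite mnm1E; case: eqP => // <-.
have vu : mdeg v = mdeg u by rewrite -[in RHS]uE !mdegD !mdeg1.
have := @all2_take_leq 0 0 _ _ (spread_mon_indices u) (spread_mon_indices v).
rewrite size_mon_indices -vu -size_mon_indices take_size; apply=> x.
rewrite -[in leqLHS]uE !count_mon_indices.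
under eq_bigr do rewrite mnmDE mulnDr.
under [leqRHS]eq_bigr do rewrite mnmDE mulnDr.
rewrite !big_split leq_add2l /= (bigD1 j) //= [leqRHS](bigD1 i) //= !mnm1E !eqxx !muln1.
rewrite !big1 ?addn0.
- by case: (leqP j x) => // jx; rewrite (leq_trans (ltnW ij) jx).
- by move=> k /negPf ki; rewrite mnm1E eq_sym ki muln0.
- by move=> k /negPf kj; rewrite mnm1E eq_sym kj muln0.
Qed.

End Indices.

(** * Strongly stable ideals have linear quotients *)

Section StronglyStable.
Variables (K : fieldType) (n t : nat).
Notation S := {mpoly K[n]}.
Variable I : S -> Prop.
Hypothesis I_stable : tspread_strongly_stable t I.
Implicit Types (g m : 'X_{1..n}) (s u v w : seq nat).

Notation bounded := (all (fun a => a < n)%N).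
Notation mono := (mono n).

Lemma stable_generates : exists A, generates A I.
Proof. by have [[A [_ AI]] _] := I_stable; exists A. Qed.

Lemma stable_lem g m : I 'X_[g] -> (g <= m)%MM -> I 'X_[m].
Proof.
have [A AI] := stable_generates.
move=> /(generatesX _ AI)[a [Aa ag]] gm; apply/(generatesX _ AI).
by exists a; split=> //; apply: lepm_trans ag gm.
Qed.

Lemma minimal_spread g : minimal_monomial I g -> spread t 0 (mon_indices g).
Proof.
have [[A [At AI]] _] := I_stable; move=> [/(generatesX _ AI)[a [Aa ag]] gmin].
rewrite -(gmin a) //; last by apply/(generatesX _ AI); exists a; rewrite lepm_refl.
by rewrite -spread_sorted; apply: At.
Qed.

(** Terms are lowered from left to right, [p] being the finished prefix. The intermediate sequence
    stays spread: up to [b] it agrees with the target, and lowering a term only widens the distance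
    to the next one. *)
Lemma stable_lower u v : spread t 0 u -> spread t 0 v -> bounded u ->
  all2 leq v u -> I 'X_[mono u] -> I 'X_[mono v].
Proof.
suff lower p : spread t 0 (p ++ u) -> spread t 0 (p ++ v) -> bounded (p ++ u) ->
    all2 leq v u -> I 'X_[mono (p ++ u)] -> I 'X_[mono (p ++ v)] by apply: (lower [::]).
elim: u v p => [|a u IHu] [|b v] // p su sv bu.
move=> /andP[ba vu] Iu; have su' : spread t 0 (p ++ b :: u).
  move: su sv; rewrite !spread_cat /= => /and3P[-> _ ua] /and3P[_ -> _] /=.
  by apply: spread_le ua => //; rewrite leq_add2r.
have bu' : bounded (p ++ b :: u).
  by move: bu; rewrite !all_cat /= => /and3P[-> an ->]; rewrite (leq_ltn_trans ba an).
suff Iu' : I 'X_[mono (p ++ b :: u)].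
  by rewrite -cat_rcons; apply: IHu => //; rewrite cat_rcons.
have [an bn] : (a < n)%N /\ (b < n)%N.
  by split; [apply: (allP bu) | apply: (allP bu')]; rewrite mem_cat inE eqxx orbT.
move: ba; rewrite leq_eqVlt => /orP[/eqP -> //|ba].
rewrite -(mono_replace p u (Ordinal bn) (Ordinal an)).
apply: I_stable.2 => //.
- by rewrite /tspread spread_sorted (monoK su bu).
- by rewrite mnmE count_cat /= eqxx addnCA.
- by rewrite mono_replace /tspread spread_sorted (monoK su' bu').
Qed.

Lemma stable_take g m : spread t 0 (mon_indices m) -> (g <= m)%MM -> I 'X_[g] ->
  spread t 0 (mon_indices g) -> I 'X_[mono (take (mdeg g) (mon_indices m))].
Proof.
move=> sm gm Ig sg.
apply: (stable_lower sg (spread_take _ sm) (mon_indices_lt _) (all2_take_mon_indices gm)).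
by rewrite mon_indicesK.
Qed.

(** Let [g] be a minimal generator dividing the monomial of [u]. If its degree is smaller, the first
    deg g indices of [u] are termwise at most those of [g], so this shorter prefix again lies in
    [I]. *)
Lemma stable_prefix u : spread t 0 u -> bounded u -> I 'X_[mono u] ->
  exists k, minimal_monomial I (mono (take k u)).
Proof.
have [d] := ubnP (size u); elim: d u => // d IHd u ud su bu Iu.
have [g [gmin gu]] := exists_minimal_monomial Iu.
have [ug|gu_lt] := leqP (mdeg (mono u)) (mdeg g).
  by exists (size u); rewrite take_size -(lem_mdeg_eq gu ug).
have sm : spread t 0 (mon_indices (mono u)) by rewrite (monoK su bu).
have Ip := stable_take sm gu gmin.1 (minimal_spread gmin).
rewrite (monoK su bu) in Ip; rewrite (mdeg_mono su bu) in gu_lt.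
have [|||k] := IHd (take (mdeg g) u) _ _ _ Ip.
- by rewrite size_take gu_lt; lia.
- exact: spread_take.
- by move: bu; rewrite -{1}(cat_take_drop (mdeg g) u) all_cat => /andP[].
by rewrite -take_min; exists (minn k (mdeg g)).
Qed.

Definition gap_set g : {set 'I_n} := [set j | val j \in gaps t 0 (mon_indices g)].

Lemma card_gap_set g : spread t 0 (mon_indices g) ->
  #|gap_set g| = size (gaps t 0 (mon_indices g)).
Proof.
move=> sg; rewrite cardE -(size_map val); apply/perm_size/uniq_perm.
- by rewrite map_inj_uniq ?enum_uniq //; apply: val_inj.
- exact: gaps_uniq.
move=> i; apply/mapP/idP => [[j]|ig]; first by rewrite mem_enum inE => jg ->.
have i_n := gaps_lt sg (mon_indices_lt g) ig.
by exists (Ordinal i_n); rewrite // mem_enum inE.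
Qed.

(** Decreasing, to match the reversed listing in [linear_quotients]; distinct generators may be
    tied. *)
Definition gen_order (g h : 'X_{1..n}) : bool :=
  (mdeg h < mdeg g)%N ||
  (mdeg h == mdeg g) && (sumn (mon_indices h) <= sumn (mon_indices g))%N.

Lemma stable_linear_quotients (gs : seq 'X_{1..n}) :
  uniq gs -> (forall g, g \in gs <-> minimal_monomial I g) ->
  linear_quotients (sort gen_order gs) gap_set.
Proof.
move=> gs_uniq gsP us1 g us2 gsE.
have mem_us h : h \in sort gen_order gs = (h \in gs) by rewrite mem_sort.
have ord_trans : transitive gen_order by move=> x y z; rewrite /gen_order; lia.
have : sorted gen_order (sort gen_order gs).
  by apply: sort_sorted => x y; rewrite /gen_order; lia.
have : uniq (sort gen_order gs) by rewrite sort_uniq.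
rewrite gsE (sorted_pairwise ord_trans) pairwise_cat allrel_consr cat_uniq /=.
move=> /and4P[_ _ g_us2 _] /and4P[/andP[us1_g _] _ g_ord _].
have /gsP gmin : g \in gs by rewrite -mem_us gsE mem_cat inE eqxx orbT.
have sg := minimal_spread gmin.
split; last by apply: sub_all g_ord => h; rewrite /gen_order; lia.
move=> m; apply/hasP/existsP => [[h h_us2 hm]|[i]].
  have /gsP hmin : h \in gs by rewrite -mem_us gsE mem_cat inE h_us2 !orbT.
  have sh := minimal_spread hmin; have := allP g_ord _ h_us2 => gh.
  (* Either a gap variable of [g] has larger exponent in [h], and so divides [m], or a prefix of [g]
     lies termwise below [h], which the order of the list excludes. *)
  have [|h_g|[i ig i_lt]] := gaps_or_all2_leq sg sh.
  - by rewrite !size_mon_indices; move: gh; rewrite /gen_order; lia.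
  - have Ip : I 'X_[mono (take (size (mon_indices h)) (mon_indices g))].
      apply: (stable_lower sh (spread_take _ sg) (mon_indices_lt _) h_g).
      by rewrite mon_indicesK; case: hmin.
    (* By minimality the prefix is all of [g]; then the degrees are equal and the comparison of sums
       forces [g = h]. *)
    have := gmin.2 _ Ip; rewrite -{2}[g]mon_indicesK lem_mono_take => /(_ isT) gE.
    have sz : (mdeg g <= mdeg h)%N.
      rewrite -gE (mdeg_mono (spread_take _ sg)) ?size_take ?size_mon_indices; last first.
        by apply/allP=> a /mem_take /(allP (mon_indices_lt g)).
      by case: ltnP.
    case/negP: g_us2; suff -> : g = h by [].
    apply: (can_inj (@mon_indicesK n)); apply: all2_leq_sumn.
      by move: h_g; rewrite take_oversize // !size_mon_indices.
    by move: gh; rewrite /gen_order; lia.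
  have i_n := gaps_lt sg (mon_indices_lt g) ig.
  exists (Ordinal i_n); rewrite inE ig /=.
  move/mnm_lepP/(_ (Ordinal i_n)): hm.
  rewrite mnmDE -(count_mem_mon_indices h) -(count_mem_mon_indices g) /=.
  by move/(leq_trans i_lt); rewrite -[X in (X < _)%N]add0n ltn_add2r.
(* Conversely, replacing a term [j] by the smaller [i] gives a monomial of [I] that divides x_i g; a
   minimal generator [h] dividing it is the entry sought. *)
case/andP; rewrite inE => /(gaps_replace sg)[s1 [j [s2 [gE ij sr]]]] mi.
have bg := mon_indices_lt g; have jn : (j < n)%N.
  by apply: (allP bg); rewrite gE mem_cat inE eqxx orbT.
have br : bounded (s1 ++ val i :: s2).
  by move: bg; rewrite gE !all_cat /= ltn_ord => /and3P[-> _ ->].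
have rE : mono (s1 ++ val i :: s2) = (g - U_(Ordinal jn) + U_(i))%MM.
  by rewrite -[g in RHS]mon_indicesK gE -(mono_replace s1 s2 i (Ordinal jn)).
have Ir : I 'X_[mono (s1 ++ val i :: s2)].
  apply: (stable_lower sg sr (mon_indices_lt _)); last by rewrite mon_indicesK; case: gmin.
  rewrite gE; elim: s1 {gE sr br rE} => [|a s1 IHs1] /=; last by rewrite leqnn.
  by rewrite (ltnW ij) /=; elim: s2 => //= a s2 ->; rewrite leqnn.
have [h [hmin hr]] := exists_minimal_monomial Ir.
exists h; last first.
  apply: lepm_trans hr _; rewrite rE; apply/mnm_lepP=> k.
  rewrite !mnmDE mnmBE addnC; apply: leq_add (leq_subr _ _).
  by rewrite mnm1E; case: eqP => // <-.
have h_deg : (mdeg h <= mdeg g)%N.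
  rewrite (leq_trans (lem_mdeg hr)) // (mdeg_mono sr br) -size_mon_indices gE.
  by rewrite !size_cat.
(* [h] comes strictly after [g]: its degree is smaller, or it is the replaced monomial itself, whose
   index sum is smaller by j - i. *)
have h_lt : gen_order g h && ~~ gen_order h g.
  move: h_deg; rewrite leq_eqVlt => /orP[/eqP h_deg|]; last by rewrite /gen_order; lia.
  have hE : h = mono (s1 ++ val i :: s2).
    apply: lem_mdeg_eq => //; rewrite h_deg (mdeg_mono sr br) -size_mon_indices gE.
    by rewrite !size_cat.
  rewrite /gen_order h_deg hE (monoK sr br) gE !sumn_cat /= ltnn eqxx /=.
  by rewrite -ltnNge !leq_add2l leq_add2r ltn_add2l ltn_add2r (ltnW ij).
have : h \in sort gen_order gs by rewrite mem_us; apply/gsP.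
rewrite gsE mem_cat inE => /or3P[h_us1|/eqP hg|//].
  by move: h_lt; rewrite (allP us1_g _ h_us1) andbF.
by move: h_lt; rewrite hg; case: gen_order.
Qed.

End StronglyStable.

(** A formula of Eliahou-Kervaire type, with q(g) expressed as the total length of the gaps. *)
Lemma graded_betti_stable (K : fieldType) n t (I : {mpoly K[n]} -> Prop)
    (F : free_seq K n) (gs : seq 'X_{1..n}) i (k : int) :
  tspread_strongly_stable t I -> graded_free_resolution F I ->
  uniq gs -> (forall g, g \in gs <-> minimal_monomial I g) ->
  graded_betti F i k = (\sum_(g <- gs) (k == (i + mdeg g)%:Z) *
                          'C(size (gaps t 0 (mon_indices g)), i))%N.
Proof.
move=> I_stable rF gs_uniq gsP.
have lq := stable_linear_quotients I_stable gs_uniq gsP.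
have [A AI] := stable_generates I_stable.
have mideal_I p :
    mideal (fun m => has (fun g => g <= m)%MM (sort (@gen_order n) gs)) p <-> I p.
  rewrite (generates_msupp p AI); split=> [/allP Ip m m_p|Ip].
    have /hasP[g] := Ip m m_p; rewrite mem_sort => /gsP[Ig _] gm.
    exact: (stable_lem I_stable Ig).
  apply/allP=> m /Ip /exists_minimal_monomial[g [/gsP g_gs gm]].
  by apply/hasP; exists g; rewrite ?mem_sort.
have mr := minimally_resolved_ext (minimally_resolved_linear_quotients K lq) mideal_I
  (fun _ _ => erefl).
rewrite (graded_betti_minimal i k mr rF).
rewrite (perm_big gs) /=; last by rewrite perm_sort.
apply: eq_big_seq => g /gsP /(minimal_spread I_stable) sg.
by rewrite card_gap_set.
Qed.

(** * Stability and minimal generators of the ideal of the sigma(u) *)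

Section Sigma.
Variables (K : fieldType) (n N t : nat) (I : {mpoly K[n]} -> Prop).
Hypothesis I_stable : tspread_strongly_stable t I.
Hypothesis N_large :
  forall u, mingens I u -> all (fun k => (k < N)%N) (sigma_indices u).
Implicit Types (u g : 'X_{1..n}).

Notation J := (sigma_ideal (N := N) I).

Lemma sigmaE u : sigma N u = mono N (shift 0 (mon_indices u)).
Proof. by rewrite -shiftE. Qed.

Lemma stable_mingensP u : mingens I u <-> minimal_monomial I u.
Proof. by have [A AI] := stable_generates I_stable; apply: mingensP AI. Qed.

Lemma spread_sigma_indices u : minimal_monomial I u ->
  spread t.+1 0 (shift 0 (mon_indices u)).
Proof. by move/(minimal_spread I_stable)/(spread_shift 0). Qed.

Lemma mon_indices_sigma u : minimal_monomial I u ->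
  mon_indices (sigma N u) = shift 0 (mon_indices u).
Proof.
move=> umin; rewrite sigmaE (monoK (spread_sigma_indices umin)) // -shiftE.
by apply: N_large; apply/stable_mingensP.
Qed.

Lemma mdeg_sigma u : minimal_monomial I u -> mdeg (sigma N u) = mdeg u.
Proof. by move=> umin; rewrite -!size_mon_indices mon_indices_sigma // size_shift. Qed.

Lemma sigma_generates : generates (fun w => exists2 u, mingens I u & w = sigma N u) J.
Proof. by []. Qed.

Lemma sigma_idealP m :
  J 'X_[m] <-> exists u, minimal_monomial I u /\ (sigma N u <= m)%MM.
Proof.
rewrite (generatesX m sigma_generates); split=> [[w [[u /stable_mingensP Mu ->] um]]|].
  by exists u.
by case=> u [/stable_mingensP Mu um]; exists (sigma N u); split=> //; exists u.
Qed.

(* If z is termwise at most sigma(u), then sigma^-1(z) lies in I, so some beginning of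
   sigma^-1(z) is a minimal generator, and sigma of it is a beginning of z. *)
Lemma sigma_ideal_lower u z : minimal_monomial I u -> spread t.+1 0 z ->
  all2 leq z (shift 0 (mon_indices u)) -> J 'X_[mono N z].
Proof.
move=> umin sz zu; pose v := unshift 0 z.
have zE : shift 0 v = z by apply: (@unshiftK t 0).
have sv : spread t 0 v by apply: spread_unshift.
have vu : all2 leq v (mon_indices u) by rewrite -(all2_leq_shift 0) zE.
have bv := all2_leq_lt vu (mon_indices_lt u).
have [|k kmin] := stable_prefix I_stable sv bv.
  apply: (stable_lower I_stable (minimal_spread I_stable umin) sv (mon_indices_lt u) vu).
  by rewrite mon_indicesK; case: umin.
apply/sigma_idealP; exists (mono n (take k v)); split=> //.
rewrite sigmaE (monoK (spread_take k sv)) -?take_shift ?zE ?lem_mono_take //.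
by apply/allP=> a /mem_take /(allP bv).
Qed.

(** Some sigma(u) divides [w], and lowering an index keeps the first deg u indices termwise at most
    those of sigma(u). So [sigma_ideal_lower] applies to this prefix of the new monomial. *)
Lemma sigma_ideal_stable : tspread_strongly_stable t.+1 J.
Proof.
split=> [|w i j _ /sigma_idealP[u [umin uw]] wj ij sw'].
  eexists; split; last exact: sigma_generates.
  move=> _ [u /stable_mingensP umin ->].
  by rewrite /tspread spread_sorted mon_indices_sigma // spread_sigma_indices.
set w' := (w - U_(j) + U_(i))%MM in sw' *.
rewrite /tspread spread_sorted in sw'.
have := sigma_ideal_lower umin (spread_take (mdeg (sigma N u)) sw').
case/(_ _)/sigma_idealP=> [|g [gmin gw']].
  rewrite -mon_indices_sigma //; apply: all2_leq_trans (all2_take_mon_indices uw).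
  exact: all2_leq_take (all2_mon_indices_lower ij wj).
apply/sigma_idealP; exists g; split=> //; apply: lepm_trans gw' _.
by rewrite -{2}[w']mon_indicesK lem_mono_take.
Qed.

(** Let sigma(g) divide [v] and [v] divide sigma(u). Undoing the shift, the first deg g indices of
    [u] are termwise at most those of [g], so this prefix lies in [I] and is [u] by minimality. Thus
    deg u <= deg g <= deg v, and v = sigma(u). *)
Lemma sigma_ideal_minimalP w :
  minimal_monomial J w <-> exists2 u, minimal_monomial I u & w = sigma N u.
Proof.
split=> [[/sigma_idealP[u [umin uw]] wmin]|[u umin ->]].
  exists u => //; symmetry; apply: wmin => //.
  by apply/sigma_idealP; exists u; rewrite lepm_refl.
split=> [|v /sigma_idealP[g [gmin gv]] vu].
  by apply/sigma_idealP; exists u; rewrite lepm_refl.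
apply: lem_mdeg_eq => //; apply: leq_trans (lem_mdeg gv).
have := all2_take_mon_indices (lepm_trans gv vu).
rewrite !mon_indices_sigma // !mdeg_sigma // take_shift all2_leq_shift => ug.
have su := minimal_spread I_stable umin.
have Ip := stable_lower I_stable (minimal_spread I_stable gmin) (spread_take _ su)
  (mon_indices_lt _) ug.
rewrite mon_indicesK in Ip; have [Ig _] := gmin; have [_ umin'] := umin.
rewrite -(umin' _ (Ip Ig)); last by rewrite -{2}[u]mon_indicesK lem_mono_take.
rewrite (mdeg_mono (spread_take _ su)) ?size_take ?size_mon_indices.
  by case: ltnP.
by apply/allP=> a /mem_take /(allP (mon_indices_lt u)).
Qed.

End Sigma.

Theorem theorem1p11 (K : fieldType) (t n N : nat) (I : {mpoly K[n]} -> Prop)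
    (hI : tspread_strongly_stable t I)
    (hN : forall u, mingens I u -> all (fun k => (k < N)%N) (sigma_indices u))
    (F : free_seq K n) (F' : free_seq K N)
    (hF : graded_free_resolution F I)
    (hF' : graded_free_resolution F' (sigma_ideal (N := N) I))
    (i : nat) (j : int) :
  graded_betti F i (i%:Z + j) = graded_betti F' i (i%:Z + j).
Proof.
have [A AI] := stable_generates hI.
have [gs [gs_uniq gsP]] := mingens_finite AI hF.2.
have [gs' [gs'_uniq gs'P]] := mingens_finite (@sigma_generates K n N I) hF'.2.
have {}gsP g : g \in gs <-> minimal_monomial I g by rewrite gsP (mingensP g AI).
have {}gs'P w : w \in gs' <-> exists2 u, minimal_monomial I u & w = sigma N u.
  by rewrite gs'P (mingensP w (@sigma_generates K n N I)) (sigma_ideal_minimalP hI hN).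
(* Sigma is injective on the minimal generators: by [hN] no shifted index is dropped, so the index
   sequence of sigma(u) determines [u]. *)
have gs'E : perm_eq gs' (map (@sigma N n) gs).
  apply: uniq_perm => //.
    rewrite map_inj_in_uniq // => u v /gsP umin /gsP vmin /(congr1 (@mon_indices N)).
    rewrite !(mon_indices_sigma hI hN) // => /shift_inj.
    exact: (can_inj (@mon_indicesK n)).
  move=> w; apply/idP/mapP => [/gs'P[u /gsP u_gs wE]|[u /gsP umin wE]]; first by exists u.
  by apply/gs'P; exists u.
rewrite (graded_betti_stable i _ hI hF gs_uniq gsP).
rewrite (graded_betti_stable i _ (sigma_ideal_stable hI hN) hF' gs'_uniq); last first.
  by move=> w; rewrite gs'P (sigma_ideal_minimalP hI hN).
(* Both sums now run over the minimal generators of [I] and agree termwise, as sigma preserves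
   degrees and gap lengths. *)
rewrite (perm_big _ gs'E) big_map; apply: eq_big_seq => g /gsP gmin.
rewrite (mdeg_sigma hI hN gmin) (mon_indices_sigma hI hN gmin).
by rewrite (size_gaps_shift t 0 0).
Qed.
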